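(* If $X$ is a proper metric space, then the covering dimension of its Higson corona $\nu(X)$ equals the coarse dimension of $X$: $\dim(\nu(X))=\dim^{coa}_{rse}(X)$.
   Context: For points of a metric space $(X,d)$, $x_k\to\infty$ means $d(x_k,x_0)\to\infty$ for some (hence every) $x_0$. Families of subsets of $X$ need not cover $X$. For a family $\mathcal U$ of subsets of $X$, $L_{\mathcal U}(x)=\sup_{U\in\mathcal U}\mathrm{dist}(x,X\setminus U)\in[0,\infty]$, with $\mathrm{dist}(x,\emptyset)=\infty$ and the supremum over the empty family equal to $0$; the Lebesgue number is $L(\mathcal U,X)=\inf_{x\in X}L_{\mathcal U}(x)$. $\mathcal U$ is coarse if $L_{\mathcal U}(x_k)\to\infty$ whenever $x_k\to\infty$. The multiplicity of $\mathcal U$ is the supremum over $x$ of the number of elements of $\mathcal U$ containing $x$. A coarse refinement of $\mathcal U$ is a coarse family each of whose elements is contained in some element of $\mathcal U$. The coarse dimension $\dim^{coa}_{rse}(X)$ is the smallest integer $n\ge-1$ such that every finite coarse family in $X$ has a coarse refinement of multiplicity at most $n+1$ ($\infty$ if there is none). A function $f:X\to Y$ of metric spaces is slowly oscillating if $f^{-1}(\mathcal W)=\{f^{-1}(W)\}_{W\in\mathcal W}$ is a coarse family in $X$ for every cover $\mathcal W$ of $Y$ with $L(\mathcal W,Y)>0$. The Higson compactification $h(X)$ of $X$ is the compact Hausdorff space containing $X$ as a dense subset with the property that a bounded continuous function $f:X\to[0,\infty)$ extends continuously over $h(X)$ if and only if $f$ is slowly oscillating. For a proper metric space (closed bounded sets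 are compact), $X$ is open in $h(X)$, and the Higson corona is $\nu(X)=h(X)\setminus X$. $\dim$ is covering dimension, with $\dim\emptyset=-1$. *)

(* Defs.v *)
From HB Require Import structures.
From mathcomp Require Import all_boot all_order all_algebra.
From mathcomp Require Import all_classical all_reals all_analysis.

Set Implicit Arguments.
Unset Strict Implicit.
Unset Printing Implicit Defensive.

Import Order.TTheory GRing.Theory Num.Theory.
Import numFieldNormedType.Exports.

Local Open Scope classical_set_scope.
Local Open Scope ring_scope.

(* The library gives [set_type A] the induced pseudometric only; its distance
   is the restriction of the ambient one. *)
Section subtype_metric.
Context {R : realType} {X : metricType R} (A : set X).

Let sdist (x y : set_type A) : R := mdist (set_val x) (set_val y).

Let sdist_ge0 x y : 0 <= sdist x y.
Proof. exact: mdist_ge0. Qed.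

Let sdist_positivity x y : sdist x y = 0 -> x = y.
Proof. by move=> /mdist_positivity; exact: val_inj. Qed.

Let ballEsdist (x : set_type A) d : ball x d = [set y | sdist x y < d].
Proof.
have -> : ball x d = set_val @^-1` ball (set_val x) d by [].
by rewrite ballEmdist.
Qed.

HB.instance Definition _ := @PseudoMetric_isMetric.Build R (set_type A)
  sdist sdist_ge0 sdist_positivity ballEsdist.

End subtype_metric.

(* The half-line [0, +oo[ as a metric space; [R^o] is the copy of [R] on which
   the library puts the metric |y - x|. *)
Definition halfline (R : realType) : set R^o := [set x : R | 0 <= x].
Arguments halfline : clear implicits.

(** Families of subsets *)
Section families.
Context {T : Type}.
Implicit Types U V : set (set T).

Definition is_cover U : Prop := \bigcup_(A in U) A = [set: T].

Definition refines V U : Prop :=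
  forall B, V B -> exists2 A, U A & B `<=` A.

Definition multiplicity_le U (m : nat) : Prop :=
  forall x : T, ([set A | U A /\ A x] #<= `I_m)%card.

End families.

(* The smallest integer n >= -1 satisfying P, and +oo if there is none. *)
Definition smallest_dim (P : int -> Prop) : \bar int :=
  xget +oo%E [set n%:E | n in [set n : int |
    [/\ -1 <= n, P n & forall m : int, -1 <= m -> P m -> n <= m]]].

(* For n >= -1, absz (n + 1) is the natural number n + 1. *)
Definition covering_dim (T : topologicalType) : \bar int :=
  smallest_dim (fun n : int =>
    forall U : set (set T), finite_set U -> U `<=` open -> is_cover U ->
    exists V : set (set T),
      [/\ finite_set V, V `<=` open, is_cover V, refines V U
        & multiplicity_le V (absz (n + 1))]).

Section coarse.
Context {R : realType} {X : metricType R}.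
Implicit Types U V : set (set X).

Definition dist_to (x : X) (A : set X) : \bar R :=
  ereal_inf [set (mdist x y)%:E | y in A].

(* 0 is adjoined so that the supremum over the empty family is 0. *)
Definition lebesgue_fun U (x : X) : \bar R :=
  ereal_sup (0%E |` [set dist_to x (~` A) | A in U]).

Definition lebesgue_number U : \bar R := ereal_inf (range (lebesgue_fun U)).

Definition tends_to_infinity (u : nat -> X) : Prop :=
  exists x0 : X, mdist (u k) x0 @[k --> \oo] --> +oo.

Definition coarse_family U : Prop :=
  forall u : nat -> X, tends_to_infinity u ->
    lebesgue_fun U (u k) @[k --> \oo] --> +oo%E.

Definition coarse_refinement V U : Prop := coarse_family V /\ refines V U.

End coarse.

Definition coarse_dim {R : realType} (X : metricType R) : \bar int :=
  smallest_dim (fun n : int =>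
    forall U : set (set X), finite_set U -> coarse_family U ->
    exists V : set (set X),
      coarse_refinement V U /\ multiplicity_le V (absz (n + 1))).

Definition proper_metric {R : realType} (X : metricType R) : Prop :=
  forall A : set X, closed A ->
    (exists M : R, forall x y, A x -> A y -> mdist x y <= M) -> compact A.

Definition slowly_oscillating {R : realType} {X Y : metricType R}
    (f : X -> Y) : Prop :=
  forall W : set (set Y), is_cover W -> (0 < lebesgue_number W)%E ->
    coarse_family [set f @^-1` B | B in W].

(* The inclusion of X in its Higson compactification hX is a map i. *)
Record higson_compactification {R : realType} {X : metricType R}
    {hX : topologicalType} (i : X -> hX) : Prop := HigsonCompactification {
  higson_compact : compact [set: hX] ;
  higson_hausdorff : hausdorff_space hX ;
  higson_inj : injective i ;
  higson_induced : forall A : set X,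
    open A <-> exists2 B : set hX, open B & A = i @^-1` B ;
  higson_dense : dense (range i) ;
  higson_extension : forall f : X -> set_type (halfline R),
    continuous f -> (exists M : R, forall x, set_val (f x) <= M) ->
    (exists2 g : hX -> set_type (halfline R),
       continuous g & forall x, g (i x) = f x)
    <-> slowly_oscillating f }.

Definition higson_corona {R : realType} {X : metricType R}
  {hX : topologicalType} (i : X -> hX) : set hX := ~` range i.

(* Main.v *)
Require Import Defs.
From mathcomp Require Import all_boot all_order all_algebra.
From mathcomp Require Import all_classical all_reals all_analysis.
From mathcomp Require Import ring lra.

(** The two dimensions agree because finite coarse families in [X] and finite
    open covers of the corona correspond to each other, with the same
    refinements and the same multiplicities.

    To a subset [A] of [X] one attaches [open_ext A], the complement in [hX] of
    the closure of [X \ A]. The heart of the matter is that a finite family [U]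
    is coarse if and only if the sets [open_ext A], for [A] in [U], cover the
    corona. If [U] is coarse, the distances to the complements, divided by one
    plus their sum, are slowly oscillating functions; their extensions to [hX]
    would all vanish at a corona point missed by the sets [open_ext A], although
    their sum stays away from 0 near the corona ([coarse_open_ext_cover]). If
    [U] is not coarse, points with a large ball in no member of [U] accumulate
    at a corona point, and a Urysohn function at this point, being slowly
    oscillating on [X], gives a contradiction ([open_ext_cover_coarse]).

    Multiplicities pass from [X] to the corona by density of [X]
    ([open_ext_finite_inter]). In the other direction an open cover of the
    corona is thickened to open sets of [hX], shrunk so that closures stay under
    control ([compact_shrinking]), and deprived of the closed set where too many
    closures meet, a set that avoids the corona ([open_multiplicity_le],
    [coarse_of_covering]). Finally a coarse refinement of a finite family can be
    made finite by merging its members ([coarse_refinement_finite]), as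
    covering dimension requires. *)

Set Implicit Arguments.
Unset Strict Implicit.
Unset Printing Implicit Defensive.

Import Order.TTheory GRing.Theory Num.Theory.
Import numFieldNormedType.Exports.

Local Open Scope classical_set_scope.
Local Open Scope ring_scope.

(** * Finite families of sets *)

Lemma card_le_sub_image {S T : Type} (P : set S) (Q : set T) (f : S -> T)
    (m : nat) :
  (P #<= `I_m)%card -> Q `<=` f @` P -> (Q #<= `I_m)%card.
Proof.
move=> Pm QP; apply: card_le_trans Pm.
exact: card_le_trans (subset_card_le QP) (card_image_le f P).
Qed.

Lemma bigcap_finite_filter {T : Type} {I : choiceType} (F : set_system T)
    (J : set I) (E : I -> set T) : Filter F -> finite_set J ->
  (forall j, J j -> F (E j)) -> F (\bigcap_(j in J) E j).
Proof.
by move=> FF /finite_fsetP[D ->] FE; apply: filter_bigI => j jD; exact: FE.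
Qed.

(** Near a point [y] only the finitely many [C j] that contain [y] can be met,
    the others being closed and missing [y]; so the number of [C j] through a
    point does not increase nearby. *)
Lemma open_multiplicity_le {T : topologicalType} {I : choiceType} (J : set I)
    (C : I -> set T) (m : nat) : finite_set J -> (forall j, closed (C j)) ->
  open [set y | ([set j | J j /\ C j y] #<= `I_m)%card].
Proof.
move=> Jfin Ccl; rewrite openE => y ym.
have : nbhs y (\bigcap_(j in J) [set z | C j z -> C j y]).
  apply: bigcap_finite_filter => // j _.
  have [Cy|nCy] := pselect (C j y); first by apply: nearW => z _.
  apply: (@filterS _ _ _ (~` C j)) => [z nCz /nCz //|].
  by apply: open_nbhs_nbhs; split => //; exact: closed_openC.
apply: filterS => z zC; apply: card_le_trans ym; apply: subset_card_le.
by move=> j [Jj Cz]; split => //; exact: zC.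
Qed.

(** * Coarse families in terms of closed balls *)

Section coarse_families.
Context {R : realType} {X : metricType R}.
Implicit Types (U V : set (set X)) (x z : X) (r : R).

Lemma lebesgue_fun_gt U x r : 0 <= r -> (r%:E < lebesgue_fun U x)%E ->
  exists2 A, U A & forall z, mdist x z <= r -> A z.
Proof.
move=> r0 /ereal_sup_gt[_ [->|[A UA <-]]]; first by rewrite lte_fin ltNge r0.
move=> rd; exists A => // z xz; apply: contrapT => nAz.
move: rd; apply/negP; rewrite -leNgt.
apply: (@le_trans _ _ (mdist x z)%:E); last by rewrite lee_fin.
by apply: ereal_inf_lbound; exists z.
Qed.

Lemma lebesgue_fun_ge U x r A : U A -> (forall z, mdist x z <= r -> A z) ->
  (r%:E <= lebesgue_fun U x)%E.
Proof.
move=> UA rA; apply: (@le_trans _ _ (dist_to x (~` A))).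
  apply: le_ereal_inf_tmp => _ [z nAz <-]; rewrite lee_fin leNgt.
  by apply/negP => /ltW /rA.
by apply: ereal_sup_ubound; right; exists A.
Qed.

(** The sequential definition becomes a uniform one: every closed ball of radius
    [r] centred far enough from a base point lies in a member of the family.
    This is the form in which coarseness is checked and used below. *)
Lemma coarse_familyP U : coarse_family U <->
  forall x0 r, exists M : R, forall x, M < mdist x x0 ->
    exists2 A, U A & forall z, mdist x z <= r -> A z.
Proof.
split=> [Uc x0 r|Uc u [x0 ux0]]; last first.
  apply/cvgeyPge => r; have [M HM] := Uc x0 r.
  move/cvgryPgt : ux0 => /(_ M); apply: filterS => k /HM[A UA rA].
  exact: lebesgue_fun_ge UA rA.
apply: contrapT => /forallNP nM.
have /choice[u Hu] : forall k : nat, exists x, k%:R < mdist x x0 /\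
    ~ exists2 A, U A & forall z, mdist x z <= r -> A z.
  by move=> k; have /existsNP[x /not_implyP[? ?]] := nM k%:R; exists x.
have u_oo : tends_to_infinity u.
  exists x0; apply/cvgryPge => M.
  near=> k; apply/ltW/(le_lt_trans _ (Hu k).1).
  by near: k; exact: nbhs_infty_ger.
have /cvgeyPge/(_ (Num.max r 0 + 1)) [k _ /(_ k (leqnn k)) kL] := Uc u u_oo.
have : ((Num.max r 0)%:E < lebesgue_fun U (u k))%E.
  by apply: lt_le_trans kL; rewrite lte_fin ltrDl.
move=> /lebesgue_fun_gt; rewrite le_max lexx orbT => /(_ isT)[A UA rA].
apply: (Hu k).2; exists A => // z zr; apply: rA.
by rewrite le_max zr.
Unshelve. all: by end_near. Qed.

(** Covering dimension asks for finite refinements, whence this reduction.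
    Sending each [B] in [V] to some [A] in [U] that contains it and merging the
    sets with the same image makes [V] finite: merging enlarges the members, so
    coarseness survives, and two merged sets through a point come from distinct
    [B]'s through that point, so the multiplicity does not grow. *)
Lemma coarse_refinement_finite U V (m : nat) : finite_set U ->
  coarse_refinement V U -> multiplicity_le V m ->
  exists W, [/\ finite_set W, coarse_refinement W U & multiplicity_le W m].
Proof.
move=> Ufin [/coarse_familyP Vc VU] Vm.
have /choice[f Hf] : forall B, exists A, V B -> U A /\ B `<=` A.
  move=> B; have [VB|nVB] := pselect (V B); last by exists B.
  by have [A UA BA] := VU B VB; exists A.
pose merge A := \bigcup_(B in [set B | V B /\ f B = A]) B.
exists [set merge A | A in U]; split.
- exact: finite_image.
- split; last first.
    move=> _ [A UA <-]; exists A => // x [B [VB <-] Bx].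
    exact: (Hf B VB).2.
  apply/coarse_familyP => x0 r; have [M HM] := Vc x0 r.
  exists M => x /HM[B VB rB]; exists (merge (f B)).
    by exists (f B) => //; exact: (Hf B VB).1.
  by move=> z /rB Bz; exists B.
- move=> x; apply: (card_le_sub_image (f := merge \o f) (Vm x)).
  by move=> _ [[A UA <-] [B [VB fBA] Bx]]; exists B => //=; rewrite fBA.
Qed.

End coarse_families.

(** * Slowly oscillating functions *)

Section slow_oscillation.
Context {R : realType} {X Y : metricType R}.

(** Balls of radius [e / 2] cover the target with positive Lebesgue number,
    which gives the variation bound; conversely a bound by some [e] below the
    Lebesgue number of a cover keeps the image of each far away ball of radius [r] inside
    one member. *)
Lemma slowly_oscillatingP (f : X -> Y) : slowly_oscillating f <->
  forall x0 (e r : R), 0 < e -> exists M : R, forall x, M < mdist x x0 ->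
    forall z, mdist x z <= r -> mdist (f x) (f z) < e.
Proof.
split=> [fs x0 e r e0|Hf W _ L0].
- pose W := [set [set z | mdist y z < e / 2] | y in [set: Y]].
  have Wc : is_cover W.
    apply/seteqP; split=> // y _; exists [set z | mdist y z < e / 2].
      by exists y.
    by rewrite /= mdistxx divr_gt0.
  have L0 : (0 < lebesgue_number W)%E.
    (* the closed ball of radius e / 3 fits in the open ball of radius e / 2 *)
    apply: (@lt_le_trans _ _ (e / 3)%:E); first by rewrite lte_fin divr_gt0.
    apply: le_ereal_inf_tmp => _ [y _ <-].
    apply: (@lebesgue_fun_ge _ _ _ _ _ [set z | mdist y z < e / 2]).
      by exists y.
    by move=> z /= /le_lt_trans; apply; lra.
  have /coarse_familyP/(_ x0 r)[M HM] := fs W Wc L0.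
  exists M => x /HM[_ [_ [y _ <-] <-] /= yB] z xz.
  have yz := yB z xz.
  have yx : mdist y (f x) < e / 2.
    by apply: yB; rewrite mdistxx (le_trans _ xz)// mdist_ge0.
  have := metric_triangle (f x) y (f z); rewrite (metric_sym (f x) y) => h.
  by apply: (le_lt_trans h); lra.
- have [e e0 eL] : exists2 e : R, 0 < e & (e%:E < lebesgue_number W)%E.
    case: (lebesgue_number W) L0 => [l||]//.
      rewrite lte_fin => l0; exists (l / 2); first by rewrite divr_gt0.
      by rewrite lte_fin; lra.
    by exists 1 => //; rewrite ltry.
  apply/coarse_familyP => x0 r; have [M HM] := Hf x0 e r e0.
  exists M => x /HM xM.
  have : (e%:E < lebesgue_fun W (f x))%E.
    by apply: lt_le_trans eL _; apply: ereal_inf_lbound; exists (f x).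
  move=> /(lebesgue_fun_gt (ltW e0))[B WB eB].
  exists (f @^-1` B); first by exists B.
  by move=> z /xM/ltW/eB.
Qed.

End slow_oscillation.

(** * Distance to a set *)

Section distance.
Context {R : realType} {X : metricType R}.
Implicit Types (A : set X) (x z : X).

(** A real number, unlike [dist_to]; it is 0 when [A] is empty, which keeps the
    function nonnegative and 1-Lipschitz in every case. *)
Definition infdist x A : R := inf [set mdist x y | y in A].

Let has_lb x A : has_lbound [set mdist x y | y in A].
Proof. by exists 0 => _ [y _ <-]; exact: mdist_ge0. Qed.

Lemma infdist_ge A x (r : R) : A !=set0 ->
  (forall y, A y -> r <= mdist x y) -> r <= infdist x A.
Proof.
move=> [y Ay] rA; apply: lb_le_inf; first by exists (mdist x y), y.
by move=> _ [z Az <-]; exact: rA.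
Qed.

Lemma infdist_le A x y : A y -> infdist x A <= mdist x y.
Proof. by move=> Ay; apply: ge_inf => //; exists y. Qed.

Lemma infdist0 x : infdist x set0 = 0.
Proof. by rewrite /infdist image_set0 inf0. Qed.

Lemma infdist_ge0 A x : 0 <= infdist x A.
Proof.
have [->|/set0P A0] := eqVneq A set0; first by rewrite infdist0.
by apply: infdist_ge => // y _; exact: mdist_ge0.
Qed.

Lemma infdist_eq0 A x : A x -> infdist x A = 0.
Proof.
move=> Ax; apply/eqP; rewrite eq_le infdist_ge0 andbT.
by rewrite -(mdistxx x) infdist_le.
Qed.

Lemma infdist_lip A x z : `|infdist x A - infdist z A| <= mdist x z.
Proof.
have [->|/set0P A0] := eqVneq A set0.
  by rewrite !infdist0 subrr normr0 mdist_ge0.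
have half a b : infdist a A <= infdist b A + mdist a b.
  rewrite -lerBlDr; apply: infdist_ge => // y Ay; rewrite lerBlDl.
  exact: le_trans (infdist_le _ Ay) (metric_triangle _ _ _).
have := half x z; have := half z x; rewrite (metric_sym z x) ler_norml.
by move=> h1 h2; apply/andP; split; lra.
Qed.

End distance.

(** Variation of [p / (1 + S)] between two points at which its ingredients take
    the values [p], [S] and [q], [T]. The denominator on the right makes such a
    quotient slowly oscillating as soon as [S] tends to infinity and both [p]
    and [S] are Lipschitz. *)
Lemma ratio_variation {R : realType} (p q S T d k : R) :
  0 <= p -> 0 <= q <= T -> 0 <= S -> `|p - q| <= d -> `|S - T| <= k * d ->
  `|p / (1 + S) - q / (1 + T)| <= (k + 1) * d / (1 + S).
Proof.
move=> p0 /andP[q0 qT] S0 pq ST.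
have S1 : 0 < 1 + S by lra.
have T1 : 0 < 1 + T by lra.
have -> : p / (1 + S) - q / (1 + T) =
    ((p - q) - (q / (1 + T)) * (S - T)) / (1 + S).
  by field; rewrite !gt_eqF.
have i0 : 0 <= (1 + S)^-1 by rewrite invr_ge0 ltW.
rewrite normrM (ger0_norm i0) ler_wpM2r//.
apply: le_trans (ler_normB _ _) _; rewrite normrM.
have q1 : `|q / (1 + T)| <= 1.
  rewrite ger0_norm ?divr_ge0 ?(ltW T1)// ler_pdivrMr//; lra.
have : `|q / (1 + T)| * `|S - T| <= 1 * (k * d) by rewrite ler_pM.
lra.
Qed.

(** * Proper metric spaces and compact regular spaces *)

Section metric_topology.
Context {R : realType} {X : metricType R}.

Lemma lipschitz_fun_continuous (f : X -> R) (k : R) : 0 <= k ->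
  (forall x z, `|f x - f z| <= k * mdist x z) -> continuous f.
Proof.
move=> k0 fk x; apply/(@cvgrPdist_lt _ R^o) => e e0.
have d0 : 0 < e / (k + 1) by rewrite divr_gt0// ltr_wpDl.
have := nbhsx_ballx x _ d0; rewrite ballEmdist; apply: filterS => z /= xz.
apply: le_lt_trans (fk x z) _; move: xz; rewrite ltr_pdivlMr ?ltr_wpDl//.
by have := mdist_ge0 x z; lra.
Qed.

Definition cball (x0 : X) (M : R) : set X := [set x | mdist x x0 <= M].

Lemma cball_closed x0 M : closed (cball x0 M).
Proof.
have -> : cball x0 M = (fun x => mdist x x0) @^-1` [set t | t <= M] by [].
apply: closed_comp; last exact: closed_le.
move=> x _; apply: (@lipschitz_fun_continuous _ 1) => // {}x z.
have := metric_triangle x z x0; have := metric_triangle z x x0.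
rewrite (metric_sym z x) mul1r ler_norml => h1 h2.
by apply/andP; split; lra.
Qed.

Lemma cball_compact x0 M : proper_metric X -> compact (cball x0 M).
Proof.
move=> Xp; apply: Xp; first exact: cball_closed.
exists (M + M) => x y xM yM; apply: le_trans (metric_triangle x x0 y) _.
by rewrite (metric_sym x0); exact: lerD.
Qed.

End metric_topology.

(** Call a family [G] good when its members are open and have closure in the
    corresponding [P j]. Pointwise unions of good families are good, so good
    families are directed, and by regularity each point of [K] is covered by
    some good family near it. Compactness, in its near-covering form along the
    filter of large good families, then gives one good family covering [K]. *)
Lemma compact_shrinking {T : topologicalType} {I : Type} (K : set T)
    (J : set I) (P : I -> set T) :
  compact K -> regular_space T -> (forall j, J j -> open (P j)) ->
  K `<=` \bigcup_(j in J) P j ->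
  exists G : I -> set T, [/\ forall j, open (G j),
    forall j, closure (G j) `<=` P j & K `<=` \bigcup_(j in J) G j].
Proof.
move=> /compact_near_coveringP Kc Treg Po KP.
pose good (G : I -> set T) := forall j, open (G j) /\ closure (G j) `<=` P j.
pose above (G G' : I -> set T) := good G' /\ forall j, G j `<=` G' j.
have FF : Filter (filter_from good above).
  apply: filter_from_filter.
    by exists (fun=> set0) => j; rewrite closure0; split => //; exact: open0.
  move=> G1 G2 g1 g2; exists (fun j => G1 j `|` G2 j).
    move=> j; have [[op1 cl1] [op2 cl2]] := (g1 j, g2 j).
    by split; [exact: openU|rewrite closureU subUset].
  by move=> G' [gG' uG']; split; split=> // j x Gx; apply: uG'; [left|right].
pose covered (G : I -> set T) x := exists2 j, J j & G j x.
have [G gG GK] : \forall G \near filter_from good above, K `<=` covered G.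
  apply: Kc => x Kx; have [j Jj Pjx] := KP x Kx.
  have [N xN NP] := Treg x (P j) (open_nbhs_nbhs (conj (Po j Jj) Pjx)).
  pose G0 j' := [set y | j' = j /\ N° y].
  exists (N°, above G0).
    split=> /=; first exact: nbhs_interior.
    exists G0 => // j'; have [->|jj'] := pselect (j' = j).
      have -> : G0 j = N° by apply/seteqP; split=> y // [].
      split; first exact: open_interior.
      exact: subset_trans (closureS (@interior_subset _ N)) NP.
    have -> : G0 j' = set0 by apply/seteqP; split=> y // [].
    by rewrite closure0; split => //; exact: open0.
  by move=> [y G] /= [Ny [_ GG]]; exists j => //; apply: GG.
exists G; split=> [j|j|x Kx].
- by have [] := gG j.
- by have [] := gG j.
- have [j Jj Gjx] : covered G x by apply: GK Kx; split=> // j y.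
  by exists j.
Qed.

(** * The Higson corona *)

Section higson.
Context {R : realType} {X : metricType R} {hX : topologicalType} (i : X -> hX).
Context (Xp : proper_metric X) (iH : higson_compactification i).

Let nu := higson_corona i.

Lemma higson_continuous : continuous i.
Proof.
apply/continuousP => B Bo; apply/(higson_induced iH); by exists B.
Qed.

Lemma higson_regular : regular_space hX.
Proof.
move=> h; apply: (@compact_regular _ h [set: hX]).
- exact: higson_hausdorff iH.
- exact: higson_compact iH.
- exact: filterT.
Qed.

Lemma higson_cball_closed x0 M : closed (i @` cball x0 M).
Proof.
apply: compact_closed; first exact: higson_hausdorff iH.
apply: continuous_compact; last exact: cball_compact.
exact/continuous_subspaceT/higson_continuous.
Qed.

(** Local compactness of [X] in action: an open [B] of [hX] whose trace on [X]
    is a neighbourhood of [x] in the unit ball cannot leave the compact, hence closed, image of the closed ball, since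
    the excess would be a nonempty open set missing the dense subset [X]. *)
Lemma higson_cball_nbhs x : nbhs (i x) (i @` cball x 1).
Proof.
have /(higson_induced iH)[B Bo xB] : open (ball x 1)° by exact: open_interior.
have Bi : B (i x).
  rewrite -[B _]/((i @^-1` B) x) -xB; apply: nbhs_singleton.
  apply: nbhs_interior.
  by apply: nbhsx_ballx.
apply: (@filterS _ _ _ B); last exact: open_nbhs_nbhs.
move=> h Bh; apply: contrapT => nh.
have [||y [[Bz nz] [z _ zE]]] :=
    higson_dense iH (O := B `&` ~` (i @` cball x 1)).
- by exists h.
- by apply: openI => //; exact/closed_openC/higson_cball_closed.
- rewrite -zE in Bz nz; apply: nz; exists z => //.
  have : (i @^-1` B) z by [].
  rewrite -xB => /interior_subset.
  by rewrite ballEmdist /cball /= metric_sym => /ltW.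
Qed.

Lemma higson_range_open : open (range i).
Proof.
rewrite openE => _ [x _ <-]; apply: filterS (higson_cball_nbhs x).
by move=> _ [y _ <-]; exists y.
Qed.

Lemma corona_compact : compact nu.
Proof.
apply: (subclosed_compact _ (higson_compact iH)) => //.
exact/open_closedC/higson_range_open.
Qed.

Lemma higson_dense_nbhs (h : hX) (N : set hX) : nbhs h N -> exists x, N (i x).
Proof.
move=> /nbhs_interior hN.
have [||y [/interior_subset Nx [x _ xE]]] := higson_dense iH (O := N°).
- by exists h; exact: nbhs_singleton.
- exact: open_interior.
- by exists x; rewrite xE.
Qed.

(** Points of the corona are limits of points of [X] going to infinity, because
    the image of a closed ball is closed in [hX] and misses the corona. *)
Lemma corona_far (h : hX) (N : set hX) x0 (M : R) : nu h -> nbhs h N ->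
  exists x, N (i x) /\ M < mdist x x0.
Proof.
move=> nuh hN.
have [|x [Nx Mx]] := @higson_dense_nbhs h (N `&` ~` (i @` cball x0 M)).
  apply: filterI => //; apply: open_nbhs_nbhs; split.
    exact/closed_openC/higson_cball_closed.
  by move=> [y _ yh]; apply: nuh; exists y.
exists x; split => //; rewrite ltNge; apply/negP => xM.
by apply: Mx; exists x.
Qed.

Lemma higson_extend (f : X -> R) : (forall x, 0 <= f x <= 1) ->
  continuous f ->
  (forall x0 (e r : R), 0 < e -> exists M : R, forall x, M < mdist x x0 ->
    forall z, mdist x z <= r -> `|f x - f z| < e) ->
  exists2 g : hX -> R, continuous g & forall x, g (i x) = f x.
Proof.
move=> f01 fc fs.
have f0 x : f x \in halfline R by apply/mem_set; case/andP: (f01 x).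
pose f' (x : X) : set_type (halfline R) := exist _ (f x) (f0 x).
have f'c : continuous f' by apply: continuous_comp_initial; exact: fc.
have f'b : exists M : R, forall x, set_val (f' x) <= M.
  by exists 1 => x; case/andP: (f01 x).
have [|g gc gf] := (higson_extension iH f'c f'b).2.
  apply/slowly_oscillatingP => x0 e r e0; have [M HM] := fs x0 e r e0.
  by exists M => x xM z xz; rewrite metric_sym; exact: HM.
exists (fun h => set_val (g h)); last by move=> x; rewrite gf.
move=> h; apply: continuous_comp; first exact: gc.
exact: initial_continuous.
Qed.

Lemma higson_restrict (g : hX -> R) : (forall h, 0 <= g h <= 1) ->
  continuous g ->
  forall x0 (e r : R), 0 < e -> exists M : R, forall x, M < mdist x x0 ->
    forall z, mdist x z <= r -> `|g (i x) - g (i z)| < e.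
Proof.
move=> g01 gc.
have g0 h : g h \in halfline R by apply/mem_set; case/andP: (g01 h).
pose g' (h : hX) : set_type (halfline R) := exist _ (g h) (g0 h).
have g'c : continuous g' by apply: continuous_comp_initial; exact: gc.
have ic : continuous (g' \o i).
  by move=> x; apply: continuous_comp; [exact: higson_continuous|exact: g'c].
have gib : exists M : R, forall x, set_val ((g' \o i) x) <= M.
  by exists 1 => x; case/andP: (g01 (i x)).
have := (higson_extension iH ic gib).1 (ex_intro2 _ _ g' g'c (fun=> erefl)).
move=> /slowly_oscillatingP Hs x0 e r e0; have [M HM] := Hs x0 e r e0.
by exists M => x xM z xz; rewrite distrC; exact: HM xM z xz.
Qed.

(** The largest open subset of [hX] whose trace on [X] lies in [A]. *)
Definition open_ext (A : set X) : set hX := ~` closure (i @` (~` A)).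

Lemma open_ext_open A : open (open_ext A).
Proof. exact/closed_openC/closed_closure. Qed.

Lemma sub_open_ext (G : set hX) : open G -> G `<=` open_ext (i @^-1` G).
Proof.
move=> Go h Gh /(_ G (open_nbhs_nbhs (conj Go Gh))).
by move=> [_ [[x nGx <-] Gx]].
Qed.

Lemma nbhs_open_ext A h : open_ext A h -> nbhs h (open_ext A).
Proof.
by move=> Ah; apply: open_nbhs_nbhs; split => //; exact: open_ext_open.
Qed.

Lemma open_ext_val A x : open_ext A (i x) -> A x.
Proof.
move=> Ax; apply: contrapT => nAx; apply: Ax.
by apply: subset_closure; exists x.
Qed.

Lemma open_ext_sub_closure (A : set X) (G : set hX) :
  i @` A `<=` G -> open_ext A `<=` closure G.
Proof.
move=> AG h hA N hN.
have [x [Nx /open_ext_val Ax]] :=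
  higson_dense_nbhs (filterI hN (nbhs_open_ext hA)).
by exists (i x); split => //; apply: AG; exists x.
Qed.

(** Finite intersections of the sets [open_ext B] are open, so density of [X]
    turns a common point in [hX] into one in [X]. Hence passing from a family to
    its open extensions does not increase the multiplicity. *)
Lemma open_ext_finite_inter (Q : set (set X)) h : finite_set Q ->
  (forall B, Q B -> open_ext B h) -> exists x, forall B, Q B -> B x.
Proof.
move=> Qfin Qh.
have : nbhs h (\bigcap_(B in Q) open_ext B).
  by apply: bigcap_finite_filter => // B /Qh; exact: nbhs_open_ext.
move=> /higson_dense_nbhs[x Bx]; exists x => B QB.
by apply: open_ext_val; exact: Bx.
Qed.

(** Suppose a corona point [h] lies in the closure of [X \ A] for every [A] in
    [U]. With [p A x] the distance of [x] to [X \ A] and [S] the sum of the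
    [p A], the functions [p A / (1 + S)] are slowly oscillating because
    coarseness makes [S] tend to infinity; so they extend over [hX], and they
    vanish at [h] because they vanish on [X \ A]. But their sum [S / (1 + S)] is
    at least [1 / 2] far away, hence near [h]. *)
Lemma coarse_open_ext_cover (U : set (set X)) :
  finite_set U -> coarse_family U ->
  nu `<=` \bigcup_(A in U) open_ext A.
Proof.
move=> /finite_seqP[s ->] /coarse_familyP Uc h nuh; apply: contrapT => nU.
have hcl A : A \in s -> closure (i @` (~` A)) h.
  by move=> As; apply: contrapT => nh; apply: nU; exists A.
(* with an empty complement, infdist would be 0 instead of infinite *)
have Ane A : A \in s -> ~` A !=set0.
  by move=> /hcl/(_ _ filterT)[_ [[x nAx _] _]]; exists x.
have [x0 _] := higson_dense_nbhs (h := h) filterT.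
pose p (A : set X) (x : X) : R := infdist x (~` A).
pose S (x : X) : R := \sum_(A <- s) p A x.
pose k : R := (size s)%:R.
have k0 : 0 <= k by exact: ler0n.
have S0 x : 0 <= S x by apply: sumr_ge0 => A _; exact: infdist_ge0.
have pS A x : A \in s -> 0 <= p A x <= S x.
  move=> As; rewrite infdist_ge0/= /S (big_rem A As)/= lerDl.
  by apply: sumr_ge0 => B _; exact: infdist_ge0.
have Slip x z : `|S x - S z| <= k * mdist x z.
  rewrite /S -sumrB; apply: le_trans (ler_norm_sum _ _ _) _.
  apply: le_trans (ler_sum _ (fun A _ => infdist_lip _ _ _)) _.
  by rewrite big_const_seq count_predT iter_addr_0 mulr_natl.
have Slarge y r : exists M : R, forall x, M < mdist x y -> r <= S x.
  have [M HM] := Uc y r; exists M => x /HM[A As rA].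
  have /andP[_] := pS A x As; apply: le_trans.
  apply: infdist_ge; first exact: Ane.
  by move=> z nAz; rewrite leNgt; apply/negP => /ltW/rA.
pose f (A : set X) (x : X) : R := p A x / (1 + S x).
have fvar A x z : A \in s ->
    `|f A x - f A z| <= (k + 1) * mdist x z / (1 + S x).
  move=> As; apply: ratio_variation => //; last exact: infdist_lip.
    exact: infdist_ge0.
  exact: pS.
have f01 A x : A \in s -> 0 <= f A x <= 1.
  move=> As; have /andP[p0 pSx] := pS A x As.
  have S1 : 0 < 1 + S x by have := S0 x; lra.
  by rewrite divr_ge0 ?(ltW S1)//= ler_pdivrMr//; lra.
(* The threshold is chosen so that the sum over the family stays below 1 / 2. *)
have fh A : A \in s ->
    nbhs h [set y | forall x, y = i x -> f A x < (2 * (k + 1))^-1].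
  move=> As; have [|||g gc gf] := @higson_extend (f A).
  - by move=> x; exact: f01.
  - apply: (@lipschitz_fun_continuous _ _ _ (k + 1)); first by lra.
    move=> x z; apply: le_trans (fvar A x z As) _.
    rewrite ler_pdivrMr; last by have := S0 x; lra.
    by rewrite ler_peMr ?mulr_ge0 ?mdist_ge0//; [lra|have := S0 x; lra].
  - move=> y e r e0; have [M HM] := Slarge y ((k + 1) * r / e).
    exists M => x /HM Sx z xz; apply: le_lt_trans (fvar A x z As) _.
    move: Sx; rewrite ler_pdivrMr// => Sx.
    rewrite ltr_pdivrMr; last by have := S0 x; lra.
    have : (k + 1) * mdist x z <= (k + 1) * r by rewrite ler_wpM2l//; lra.
    lra.
  have gh : g h = 0.
    have gcl : closed (g @^-1` [set 0]).
      by apply: closed_comp; [move=> ? _; exact: gc|exact: closed_eq].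
    have : closure (g @^-1` [set 0]) h.
      apply: (closureS _ (hcl A As)) => _ [x nAx <-] /=.
      by rewrite gf /f /p infdist_eq0 ?mul0r.
    by move/gcl.
  have : nbhs h (g @^-1` [set t | t < (2 * (k + 1))^-1]).
    apply: gc; apply: open_nbhs_nbhs; split; first exact: open_lt.
    by rewrite /= gh invr_gt0; lra.
  by apply: filterS => y /= gy x yx; rewrite -gf -yx.
have [M HM] := Slarge x0 1.
have sfin : finite_set [set` s] by exact: finite_seq.
have hfin := bigcap_finite_filter (nbhs_filter h) sfin fh.
have [x [fx /HM S1]] := corona_far x0 M nuh hfin.
pose c := (1 + S x) / (2 * (k + 1)).
have pc A : A \in s -> p A x <= c.
  move=> As; have := fx A As x erefl; rewrite ltr_pdivrMr; last lra.
  by move/ltW; rewrite mulrC.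
have : S x <= k * c.
  rewrite /S big_seq; apply: le_trans (ler_sum _ pc) _.
  by rewrite -big_seq big_const_seq count_predT iter_addr_0 mulr_natl.
rewrite /c mulrA ler_pdivlMr; last lra.
nra.
Qed.

(** If [U] is not coarse, there is a radius [r] and there are arbitrarily far
    points [x] whose closed [r]-ball lies in no member of [U]. They accumulate
    at some [h] in [hX], which is in the corona, hence in [open_ext A] for some
    [A] in [U]. A Urysohn function that is 0 at [h] and 1 on the closure of
    [X \ A] restricts to a slowly oscillating function; yet it is small at bad
    points [x] near [h], and 1 at points of [X \ A] within [r] of [x]. *)
Lemma open_ext_cover_coarse (U : set (set X)) :
  nu `<=` \bigcup_(A in U) open_ext A -> coarse_family U.
Proof.
move=> nuU; apply/coarse_familyP => x0 r; apply: contrapT => /forallNP nM.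
pose bad x := ~ exists2 A, U A & forall z, mdist x z <= r -> A z.
pose F := filter_from [set: R]
  (fun M => [set i x | x in [set x | M < mdist x x0 /\ bad x]]).
have PF : ProperFilter F.
  apply: filter_from_proper; last first.
    move=> M _; have /existsNP[x /not_implyP[xM xbad]] := nM M.
    by exists (i x), x.
  apply: filter_from_filter; first by exists 0.
  move=> M N _ _; exists (Num.max M N) => // _ [x [+ xb] <-].
  by rewrite gt_max => /andP[Mx Nx]; split; exists x.
have [h [_ hF]] := higson_compact iH PF filterT.
have Fnbhs M N : nbhs h N ->
    exists x, [/\ N (i x), M < mdist x x0 & bad x].
  move=> hN.
  have FM : F [set i x | x in [set x | M < mdist x x0 /\ bad x]] by exists M.
  by have [y [[x [xM xb] xy] Ny]] := hF _ _ FM hN; exists x; rewrite xy.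
have nuh : nu h.
  move=> [y _ yh].
  have hB : nbhs h (i @` cball y 1) by rewrite -yh; exact: higson_cball_nbhs.
  have [x [[z zy /(higson_inj iH) zx] + _]] := Fnbhs (1 + mdist y x0) _ hB.
  by move: zy; rewrite zx /cball /=; have := metric_triangle x y x0; lra.
have [A UA Ah] := nuU h nuh.
have hausX := higson_hausdorff iH.
have /(@uniform_separatorP _ R)[g [gc g01 gh gA]] :
    uniform_separator [set h] (closure (i @` (~` A))).
  apply: normal_completely_regular => //.
  - exact: compact_normal (higson_compact iH).
  - exact: hausdorff_accessible.
  - exact: closed_closure.
have {}g01 y : 0 <= g y <= 1.
  have : `[0, 1]%classic (g y) by apply: g01; exists y.
  by rewrite /= in_itv.
have {}gh : g h = 0 by apply: gh; exists h.
have [M HM] := higson_restrict g01 gc x0 r (e := 2^-1) ltac:(lra).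
have : nbhs h (g @^-1` [set t | t < 2^-1]).
  apply: gc; apply: open_nbhs_nbhs; split; first exact: open_lt.
  by rewrite /= gh; lra.
move=> /(Fnbhs M)[x [/= gx xM xb]]; apply: xb; exists A => // z xz.
apply: contrapT => nAz.
have gz : g (i z) = 1.
  by apply: gA; exists (i z) => //; apply: subset_closure; exists z.
by have := HM x xM z xz; rewrite gz ltr_norml => /andP[]; lra.
Qed.

Local Notation coronaT := (set_type nu).

Definition trace (P : set hX) : set coronaT := set_val @^-1` P.

Lemma trace_open P : open P -> open (trace P).
Proof. by move=> Po; exists P. Qed.

Lemma trace_cover (U : set (set X)) :
  nu `<=` \bigcup_(A in U) open_ext A <->
  is_cover [set trace (open_ext A) | A in U].
Proof.
split=> [nuU|Uc h nuh].
  apply/seteqP; split => // t _.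
  have [A UA At] := nuU _ (set_mem (valP t)).
  by exists (trace (open_ext A)) => //; exists A.
have [_ [A UA <-] At] : (\bigcup_(B in [set trace (open_ext A) | A in U]) B)
    (exist _ h (mem_set nuh) : coronaT) by rewrite Uc.
by exists A.
Qed.

(** The traces of the [open_ext A] form an open cover of the corona; let [V] be
    a refinement of small multiplicity. Its members extend to open sets [P C] of
    [hX], which shrink to [G C] with closure in [P C]. On the corona at most [m]
    of the closures [closure (G C)] meet at a point, but not necessarily off it;
    the points where more of them meet form a closed set disjoint from the
    corona, and removing this set from every [G C] repairs the multiplicity
    without uncovering the corona. *)
Lemma coarse_of_covering (m : nat) :
  (forall U : set (set coronaT), finite_set U -> U `<=` open -> is_cover U ->
    exists V : set (set coronaT),
      [/\ finite_set V, V `<=` open, is_cover V, refines V U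
        & multiplicity_le V m]) ->
  forall U : set (set X), finite_set U -> coarse_family U ->
    exists V : set (set X), coarse_refinement V U /\ multiplicity_le V m.
Proof.
move=> cov U Ufin Uc.
have [||| V [Vfin Vo Vc VU Vm]] := cov [set trace (open_ext A) | A in U].
- exact: finite_image.
- by move=> _ [A _ <-]; exact/trace_open/open_ext_open.
- exact/trace_cover/coarse_open_ext_cover.
have /choice[P HP] : forall C, exists P, V C ->
    [/\ open P, C = trace P & exists2 A, U A & P `<=` open_ext A].
  move=> C; have [VC|nVC] := pselect (V C); last by exists set0.
  have [_ [A UA <-] CA] := VU C VC; have [P Po PC] := Vo C VC.
  exists (P `&` open_ext A) => _; split.
  - by apply: openI => //; exact: open_ext_open.
  - rewrite -PC in CA *; apply/seteqP; split=> t; last by case.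
    by move=> Pt; split => //; exact: CA.
  - by exists A.
have [||||G [Go GP Gnu]] := @compact_shrinking _ _ nu V P.
- exact: corona_compact.
- exact: higson_regular.
- by move=> C /HP[].
- move=> h nuh; have [C VC Ot] : (\bigcup_(B in V) B)
      (exist _ h (mem_set nuh) : coronaT) by rewrite Vc.
  by exists C => //; have [_ CP _] := HP C VC; rewrite CP in Ot.
(* By the shrinking and the multiplicity of V, E contains the corona. *)
pose E := [set y | ([set C | V C /\ closure (G C) y] #<= `I_m)%card].
have Eo : open E by apply: open_multiplicity_le => // C; exact: closed_closure.
pose a C := i @^-1` (G C `&` E).
exists [set a C | C in V]; split; first split.
- apply: open_ext_cover_coarse => h nuh; have [C VC Gh] := Gnu h nuh.
  exists (a C); first by exists C.
  apply: sub_open_ext; first exact: openI.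
  split => //; pose t : coronaT := exist _ h (mem_set nuh).
  apply: card_le_trans (Vm t); apply: subset_card_le => C' [VC' GC'].
  by split => //; have [_ -> _] := HP C' VC'; exact: GP GC'.
- move=> _ [C VC <-]; have [_ _ [A UA PA]] := HP C VC.
  exists A => // x [Gx _]; apply: open_ext_val; apply: PA; apply: GP.
  exact: subset_closure.
- move=> x; have [Ex|nEx] := pselect (E (i x)).
    apply: (card_le_sub_image (f := a) Ex) => _ [[C VC <-] [Gx _]].
    by exists C => //; split => //; exact: subset_closure.
  apply: (card_le_trans (B := @set0 nat)); last exact: card_ge0.
  have -> : [set A | [set a C | C in V] A /\ A x] = set0; last exact: card_ge0.
  by apply/seteqP; split=> // _ [[C _ <-] [_ /nEx]].
Qed.

(** Here the shrinking [G] is needed because [open_ext] of the trace of [G C] on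
    [X] is only known to lie in the closure of [G C]. *)
Lemma covering_of_coarse (m : nat) :
  (forall U : set (set X), finite_set U -> coarse_family U ->
    exists V : set (set X), coarse_refinement V U /\ multiplicity_le V m) ->
  forall U : set (set coronaT), finite_set U -> U `<=` open -> is_cover U ->
    exists V : set (set coronaT),
      [/\ finite_set V, V `<=` open, is_cover V, refines V U
        & multiplicity_le V m].
Proof.
move=> coa U Ufin Uo Uc.
have /choice[P HP] : forall C, exists P, U C -> open P /\ trace P = C.
  move=> C; have [UC|nUC] := pselect (U C); last by exists set0.
  by have [P Po PC] := Uo C UC; exists P.
have [||||G [Go GP Gnu]] := @compact_shrinking _ _ nu U P.
- exact: corona_compact.
- exact: higson_regular.
- by move=> C /HP[].
- move=> h nuh; have [C UC Ot] : (\bigcup_(B in U) B)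
      (exist _ h (mem_set nuh) : coronaT) by rewrite Uc.
  by exists C => //; have [_ CP] := HP C UC; rewrite -CP in Ot.
have [||V [Vc Vm]] := coa [set i @^-1` G C | C in U].
- exact: finite_image.
- apply: open_ext_cover_coarse => h /Gnu[C UC Gh]; exists (i @^-1` G C).
    by exists C.
  exact: sub_open_ext.
have [|W [Wfin [Wc WU] Wm]] := coarse_refinement_finite _ Vc Vm.
  exact: finite_image.
exists [set trace (open_ext B) | B in W]; split.
- exact: finite_image.
- by move=> _ [A _ <-]; exact/trace_open/open_ext_open.
- exact/trace_cover/coarse_open_ext_cover.
- move=> _ [B WB <-]; have [_ [C UC <-] BG] := WU B WB.
  exists C => // t Bt; have [_ <-] := HP C UC; apply: GP.
  by apply: open_ext_sub_closure Bt => _ [x /BG Gx <-].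
- move=> t; pose Q := [set B | W B /\ open_ext B (set_val t)].
  have Qfin : finite_set Q by apply: sub_finite_set Wfin => B [].
  have [x Qx] : exists x, forall B, Q B -> B x.
    by apply: open_ext_finite_inter Qfin _ => B [_]; exact.
  apply: (card_le_sub_image (f := trace \o open_ext) (Wm x)).
  move=> _ [[B WB <-] Bt]; exists B => //.
  by split => //; exact: Qx.
Qed.

End higson.

Theorem corollary8p2 (R : realType) (X : metricType R) (hX : topologicalType)
    (i : X -> hX) :
  proper_metric X -> higson_compactification i ->
  covering_dim (set_type (higson_corona i)) = coarse_dim X.
Proof.
move=> Xp iH; congr smallest_dim; apply/funext => n; apply/propext; split.
- exact: coarse_of_covering.
- exact: covering_of_coarse.
Qed.
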